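(* Let $G$ be a finitely generated LERF group with positive rank gradient $\nabla G>0$, and let $A,B$ be finitely generated subgroups of infinite index in $G$. Then there exists a finite index subgroup $H$ of $B$ such that the subgroup $\langle A\cup H\rangle$ generated by $A$ and $H$ has infinite index in $G$.
   Context: For a group $U$, $d(U)$ denotes the minimal cardinality of a generating set of $U$. The rank gradient of a finitely generated group $G$ is $\nabla G=\inf_U \frac{d(U)-1}{[G:U]}$, where $U$ ranges over all finite index subgroups of $G$. A group $G$ is LERF (subgroup separable) if every finitely generated subgroup of $G$ is the intersection of some collection of finite index subgroups of $G$. *)

(* Defs.v *)
From Stdlib Require Import Reals List.
Open Scope R_scope.

Record Group := {
  carrier :> Type;
  gmul : carrier -> carrier -> carrier;
  gone : carrier;
  ginv : carrier -> carrier;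
  gmul_assoc : forall x y z, gmul x (gmul y z) = gmul (gmul x y) z;
  gmul_1l : forall x, gmul gone x = x;
  gmul_1r : forall x, gmul x gone = x;
  gmul_Vl : forall x, gmul (ginv x) x = gone;
  gmul_Vr : forall x, gmul x (ginv x) = gone
}.

Section GroupDefs.
Variable G : Group.

Definition subset (X Y : G -> Prop) : Prop := forall g, X g -> Y g.

Definition is_subgroup (S : G -> Prop) : Prop :=
  S (gone G) /\
  (forall x y, S x -> S y -> S (gmul G x y)) /\
  (forall x, S x -> S (ginv G x)).

Definition gen (X : G -> Prop) : G -> Prop :=
  fun g => forall S, is_subgroup S -> subset X S -> S g.

Definition generates (l : list G) (U : G -> Prop) : Prop :=
  forall g, U g <-> gen (fun x => In x l) g.

Definition fin_gen (U : G -> Prop) : Prop := exists l, generates l U.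

Definition is_rank (U : G -> Prop) (d : nat) : Prop :=
  (exists l, length l = d /\ generates l U) /\
  (forall l, generates l U -> (d <= length l)%nat).

(* [K : U] = n, for U a subgroup of K: there are n left cosets r U (r in K),
   pairwise distinct, covering K *)
Definition index_eq (K U : G -> Prop) (n : nat) : Prop :=
  exists l : list G, length l = n /\
    (forall r, In r l -> K r) /\
    (forall i j, (i < n)%nat -> (j < n)%nat -> i <> j ->
       ~ U (gmul G (ginv G (nth i l (gone G))) (nth j l (gone G)))) /\
    (forall g, K g -> exists r, In r l /\ U (gmul G (ginv G r) g)).

Definition finite_index_in (K U : G -> Prop) : Prop := exists n, index_eq K U n.

Definition whole : G -> Prop := fun _ => True.

Definition finite_index (U : G -> Prop) : Prop := finite_index_in whole U.
Definition infinite_index (U : G -> Prop) : Prop := ~ finite_index U.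

Definition rank_gradient_values (v : R) : Prop :=
  exists U d n, is_subgroup U /\ index_eq whole U n /\ is_rank U d /\
    v = (INR d - 1) / INR n.

(* nabla G > 0 : the infimum of these values is positive, i.e. they admit a
   positive lower bound *)
Definition rank_gradient_pos : Prop :=
  exists eps, 0 < eps /\ forall v, rank_gradient_values v -> eps <= v.

Definition LERF : Prop :=
  forall S, is_subgroup S -> fin_gen S ->
    forall g, S g <-> (forall U, is_subgroup U -> finite_index U -> subset S U -> U g).

End GroupDefs.

(* Main.v *)
(** Let [nabla] be a positive lower bound for the rank gradient values. A
    finite-index subgroup [W] contained in a subgroup of index [n] needs more
    than [nabla n] generators, so a subgroup generated by too few elements has
    infinite index.

    First pick finite-index subgroups [U >= A] and [V >= B] of large index, which
    exist by LERF. By Schreier, [K = <A ∩ V, B ∩ U>] is generated by at most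
    [d(A) [U : U ∩ V] + d(B) [V : U ∩ V]] elements. This is
    [[G : U ∩ V] (d(A) / [G : U] + d(B) / [G : V])], so [K] has infinite index.

    Next apply LERF to [K]: there are [V2 >= K] of arbitrarily large index, while
    [k = [A : A ∩ V]] always bounds [[A : A ∩ V2]]. Intersecting the stabilizer of the
    set [A V2] with a deep overgroup of [A] gives a finite-index [U2 >= A] with
    [U2 ⊆ A V2], whence [[U2 : U2 ∩ V2] <= k]. For [H = B ∩ U ∩ U2] the group
    [<A, H>] lies in [U2] and is generated by at most
    [d(A) + d(B ∩ U) [V2 : V2 ∩ U2] <= d(A) + d(B ∩ U) k [G : U2] / [G : V2]]
    elements, which is less than [nabla [G : U2]]. *)

Require Import Defs.
From Stdlib Require Import Reals List Lra Lia Classical ClassicalEpsilon.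

Section Subgroups.

Variable G : Group.

Local Notation "x ** y" := (gmul G x y) (at level 40, left associativity).
Local Notation "x ^-1" := (ginv G x) (at level 3, format "x ^-1").
Local Notation "1" := (gone G).

(** * Group identities, left cosets and generated subgroups *)

Lemma gmul_assoc_r (x y z : G) : (x ** y) ** z = x ** (y ** z).
Proof. symmetry; apply gmul_assoc. Qed.

Lemma gmul_Vl_cancel (x y : G) : x^-1 ** (x ** y) = y.
Proof. now rewrite gmul_assoc, gmul_Vl, gmul_1l. Qed.

Lemma gmul_Vr_cancel (x y : G) : x ** (x^-1 ** y) = y.
Proof. now rewrite gmul_assoc, gmul_Vr, gmul_1l. Qed.

Lemma ginv_unique (x y : G) : x ** y = 1 -> y = x^-1.
Proof. intro e. now rewrite <- (gmul_Vl_cancel x y), e, gmul_1r. Qed.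

Lemma ginv_inv (x : G) : (x^-1)^-1 = x.
Proof. symmetry; apply ginv_unique, gmul_Vl. Qed.

Lemma ginv_one : 1^-1 = 1.
Proof. symmetry; apply ginv_unique, gmul_1l. Qed.

Lemma ginv_mul (x y : G) : (x ** y)^-1 = y^-1 ** x^-1.
Proof.
  symmetry; apply ginv_unique.
  now rewrite gmul_assoc_r, gmul_Vr_cancel, gmul_Vr.
Qed.

(* The ten rules of the complete Knuth-Bendix system for groups: both sides of an identity valid in
   every group reduce to the same word. *)
#[local] Hint Rewrite gmul_assoc_r gmul_Vl_cancel gmul_Vr_cancel ginv_inv
  ginv_one ginv_mul gmul_Vl gmul_Vr gmul_1l gmul_1r : grp.

Ltac grp := autorewrite with grp; reflexivity.

Section Membership.

Variables (U : G -> Prop) (hU : is_subgroup G U).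

Lemma sub1 : U 1.
Proof. apply hU. Qed.

Lemma subM x y : U x -> U y -> U (x ** y).
Proof. apply hU. Qed.

Lemma subV x : U x -> U x^-1.
Proof. apply hU. Qed.

(** [U (x^-1 ** y)] encodes [x U = y U]; this and the next two lemmas make it an equivalence
    relation. *)
Lemma coset_refl x : U (x^-1 ** x).
Proof. rewrite gmul_Vl; apply sub1. Qed.

Lemma coset_sym x y : U (x^-1 ** y) -> U (y^-1 ** x).
Proof.
  intro h. replace (y^-1 ** x) with ((x^-1 ** y)^-1) by grp. now apply subV.
Qed.

Lemma coset_trans y x z : U (x^-1 ** y) -> U (y^-1 ** z) -> U (x^-1 ** z).
Proof.
  intros h1 h2. replace (x^-1 ** z) with ((x^-1 ** y) ** (y^-1 ** z)) by grp.
  now apply subM.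
Qed.

Lemma subMr x y : U x -> U (x^-1 ** y) -> U y.
Proof.
  intros h1 h2. replace y with (x ** (x^-1 ** y)) by grp. now apply subM.
Qed.

End Membership.

Definition inter (U V : G -> Prop) : G -> Prop := fun g => U g /\ V g.

Lemma inter_subgroup U V :
  is_subgroup G U -> is_subgroup G V -> is_subgroup G (inter U V).
Proof.
  intros (u1 & u2 & u3) (v1 & v2 & v3); unfold inter.
  repeat split; try tauto; firstorder.
Qed.

Lemma gen_subgroup X : is_subgroup G (gen G X).
Proof.
  split; [|split].
  - intros S hS _; apply hS.
  - intros x y hx hy S hS hX; apply hS; [apply hx | apply hy]; trivial.
  - intros x hx S hS hX; apply hS, hx; trivial.
Qed.

Lemma gen_sub X : subset G X (gen G X).
Proof. intros g hg S hS hX; auto. Qed.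

Lemma gen_least X S : is_subgroup G S -> subset G X S -> subset G (gen G X) S.
Proof. intros hS hX g hg; now apply hg. Qed.

Lemma generates_subgroup l S : generates G l S -> is_subgroup G S.
Proof.
  intro h. destruct (gen_subgroup (fun x => In x l)) as (h1 & h2 & h3).
  split; [|split].
  - now apply h.
  - intros x y hx hy; apply h; apply h2; now apply h.
  - intros x hx; apply h; apply h3; now apply h.
Qed.

Lemma generates_in l S x : generates G l S -> In x l -> S x.
Proof. intros h hx; apply h; now apply gen_sub. Qed.

Lemma generates_union l1 l2 S1 S2 :
  generates G l1 S1 -> generates G l2 S2 ->
  generates G (l1 ++ l2) (gen G (fun x => S1 x \/ S2 x)).
Proof.
  intros h1 h2 g; split; revert g; apply gen_least; try apply gen_subgroup.
  - intros g [hg | hg]; [apply h1 in hg | apply h2 in hg]; revert g hg;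
      apply gen_least; try apply gen_subgroup; intros g hg; apply gen_sub;
      apply in_or_app; tauto.
  - intros g hg; apply gen_sub; apply in_app_or in hg.
    destruct hg; [left | right]; eapply generates_in; eauto.
Qed.

(** * Transversals and indices *)

(* [U] need not be contained in [K]: all index notions below then refer to the
   index of the intersection of [K] and [U] in [K]. *)
Definition covers (K U : G -> Prop) (l : list G) : Prop :=
  forall g, K g -> exists r, In r l /\ U (r^-1 ** g).

Definition transversal (K U : G -> Prop) (l : list G) : Prop :=
  (forall r, In r l -> K r) /\ NoDup l /\
  (forall x y, In x l -> In y l -> U (x^-1 ** y) -> x = y) /\ covers K U l.

(** Passes from positions to elements: equal entries at two positions would represent one coset, so
    the list has no repetition. *)
Lemma index_eq_transversal K U n : is_subgroup G U ->
  index_eq G K U n <-> exists l, transversal K U l /\ length l = n.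
Proof.
  intro hU; split.
  - intros (l & <- & hK & hp & hc). exists l; split; [|reflexivity].
    assert (hinj : forall i j, (i < length l)%nat -> (j < length l)%nat ->
        U ((nth i l 1)^-1 ** nth j l 1) -> i = j).
    { intros i j hi hj h. destruct (PeanoNat.Nat.eq_dec i j); trivial.
      exfalso; now apply (hp i j). }
    split; [trivial | split; [|split; [|trivial]]].
    + apply (NoDup_nth l 1). intros i j hi hj e. apply hinj; trivial.
      rewrite e; now apply coset_refl.
    + intros x y hx hy h.
      destruct (In_nth l x 1 hx) as (i & hi & <-).
      destruct (In_nth l y 1 hy) as (j & hj & <-).
      f_equal; now apply hinj.
  - intros (l & (hK & hn & hp & hc) & <-). exists l; split; [reflexivity|].
    split; [trivial | split; [|trivial]].
    intros i j hi hj ne h. apply ne, (proj1 (NoDup_nth l 1) hn); trivial.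
    apply hp; trivial; now apply nth_In.
Qed.

(** Induction on [l], with [K] shrinking to its elements outside [a U]. If [K] meets [a U], a common
    element [b] takes the place of [a], which itself may lie outside [K]; otherwise [a] is
    dropped. *)
Lemma transversal_of_cover U l : is_subgroup G U -> forall K, covers K U l ->
  exists l', transversal K U l' /\ (length l' <= length l)%nat.
Proof.
  intro hU; induction l as [|a l IH]; intros K hc.
  - exists nil; split; [|trivial]. repeat split; trivial.
    + now intros r [].
    + constructor.
    + intros x y [].
  - destruct (IH (fun g => K g /\ ~ U (a^-1 ** g))) as (l' & (hK & hn & hp & hc') & hl).
    { intros g [hg na]. destruct (hc g hg) as (r & [<- | hr] & h).
      - contradiction.
      - now exists r. }
    destruct (classic (exists g, K g /\ U (a^-1 ** g))) as [(b & hb & hab) | hno].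
    + assert (hbl : forall x, In x l' -> ~ U (b^-1 ** x)).
      { intros x hx h. apply (proj2 (hK x hx)).
        now apply coset_trans with b. }
      exists (b :: l'); split; [|simpl; lia]. split; [|split; [|split]].
      * intros r [<- | hr]; [trivial | now apply hK].
      * constructor; trivial. intro hin. apply (hbl b hin).
        now apply coset_refl.
      * intros x y [<- | hx] [<- | hy] h; auto.
        -- exfalso; now apply (hbl y).
        -- exfalso; apply (hbl x); trivial. now apply coset_sym.
      * intros g hg. destruct (classic (U (a^-1 ** g))) as [h | h].
        -- exists b; split; [now left|]. apply coset_trans with a; trivial.
           now apply coset_sym.
        -- destruct (hc' g (conj hg h)) as (r & hr & h'). exists r; split; trivial.
           now right.
    + exists l'; split; [|simpl; lia]. split; [|split; [|split]]; trivial.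
      * intros r hr; now apply hK.
      * intros g hg; apply hc'; split; trivial. intro h; apply hno; now exists g.
Qed.

Lemma index_of_cover K U l : is_subgroup G U -> covers K U l ->
  exists n, index_eq G K U n /\ (n <= length l)%nat.
Proof.
  intros hU hc. destruct (transversal_of_cover U l hU K hc) as (l' & ht & hl).
  exists (length l'); split; trivial. apply index_eq_transversal; trivial.
  now exists l'.
Qed.

(** Pigeonhole: [f] sends each element of a transversal to a member of [l] in its coset, and
    elements with the same image share a coset, hence agree. *)
Lemma index_le_cover K U n l : is_subgroup G U -> index_eq G K U n ->
  covers K U l -> (n <= length l)%nat.
Proof.
  intros hU hi hc. apply index_eq_transversal in hi; trivial.
  destruct hi as (t & (hK & hn & hp & _) & <-).
  pose (f := fun x => epsilon (inhabits 1) (fun r => In r l /\ U (r^-1 ** x))).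
  assert (hf : forall x, In x t -> In (f x) l /\ U ((f x)^-1 ** x)).
  { intros x hx. apply (epsilon_spec (inhabits 1)
      (fun r => In r l /\ U (r^-1 ** x))). auto. }
  rewrite <- (length_map f t). apply NoDup_incl_length.
  - apply NoDup_map_NoDup_ForallPairs; trivial.
    intros x y hx hy e. apply hp; trivial.
    apply coset_trans with (f x); trivial.
    + apply coset_sym; trivial; now apply hf.
    + rewrite e; now apply hf.
  - intros r hr. apply in_map_iff in hr. destruct hr as (x & <- & hx). now apply hf.
Qed.

Lemma index_cover K U n : index_eq G K U n ->
  exists l, length l = n /\ covers K U l.
Proof. intros (l & hl & _ & _ & hc). now exists l. Qed.

(** Representatives of [K'] modulo [U'] also represent [K] modulo [U]: each [U]-coset of an element
    of [K] meets [K'], and on [K'] being congruent modulo [U'] implies it modulo [U]. *)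
Lemma index_le K U n K' U' : is_subgroup G U -> index_eq G K' U' n ->
  (forall g, K g -> exists x, K' x /\ U (x^-1 ** g)) ->
  (forall x y, K' x -> K' y -> U' (x^-1 ** y) -> U (x^-1 ** y)) ->
  exists m, index_eq G K U m /\ (m <= n)%nat.
Proof.
  intros hU (l & <- & hK & _ & hc) hcov hsub. apply index_of_cover; trivial.
  intros g hg. destruct (hcov g hg) as (x & hx & hxg).
  destruct (hc x hx) as (r & hr & hrx). exists r; split; trivial.
  apply coset_trans with x; trivial. apply hsub; auto.
Qed.

Lemma index_subset_l K K' U n : is_subgroup G U -> index_eq G K' U n ->
  subset G K K' -> exists m, index_eq G K U m /\ (m <= n)%nat.
Proof.
  intros hU hi hs. apply index_le with K' U; trivial.
  intros g hg; exists g; split; auto. now apply coset_refl.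
Qed.

Lemma index_mono K U U' n n' : is_subgroup G U' -> index_eq G K U n ->
  index_eq G K U' n' -> subset G U U' -> (n' <= n)%nat.
Proof.
  intros hU' hi hi' hs. destruct (index_cover K U n hi) as (l & <- & hc).
  apply index_le_cover with K U'; trivial.
  intros g hg; destruct (hc g hg) as (r & hr & h); exists r; auto.
Qed.

Lemma index_pos K U n : K 1 -> index_eq G K U n -> (0 < n)%nat.
Proof.
  intros h1 (l & <- & _ & _ & hc). destruct (hc 1 h1) as (r & hr & _).
  destruct l; [easy | simpl; lia].
Qed.

Lemma NoDup_list_prod {S T : Type} (l : list S) (l' : list T) :
  NoDup l -> NoDup l' -> NoDup (list_prod l l').
Proof.
  intros hl hl'; induction hl as [|a l ha hl IH]; simpl; [constructor|].
  apply NoDup_app; trivial.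
  - apply NoDup_map_NoDup_ForallPairs; trivial. now intros x y _ _ [= e].
  - intros p hp hp'. apply in_map_iff in hp; destruct hp as (y & <- & _).
    apply in_prod_iff in hp'. tauto.
Qed.

(** Products of representatives form a transversal: the class modulo [U] determines the first
    factor, then the class modulo [T] the second. *)
Lemma index_tower K U T a b :
  is_subgroup G K -> is_subgroup G U -> is_subgroup G T -> subset G U K ->
  index_eq G K U a -> index_eq G U T b -> index_eq G K (inter U T) (a * b).
Proof.
  intros hK hU hT hUK ha hb.
  apply index_eq_transversal in ha; trivial.
  apply index_eq_transversal in hb; trivial.
  apply index_eq_transversal; [now apply inter_subgroup|].
  destruct ha as (l & (lK & ln & lp & lc) & <-).
  destruct hb as (t & (tK & tn & tp & tc) & <-).
  set (f := fun p : G * G => fst p ** snd p).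
  assert (hinj : forall x y, In x (list_prod l t) -> In y (list_prod l t) ->
      inter U T ((f x)^-1 ** f y) -> x = y).
  { intros [x1 x2] [y1 y2] hx hy [h1 h2]; unfold f in h1, h2; simpl in h1, h2.
    apply in_prod_iff in hx; apply in_prod_iff in hy.
    destruct hx as [hx1 hx2], hy as [hy1 hy2].
    assert (e : x1 = y1).
    { apply lp; trivial.
      replace (x1^-1 ** y1) with (x2 ** ((x1 ** x2)^-1 ** (y1 ** y2)) ** y2^-1) by grp.
      apply subM; [trivial | apply subM | apply subV]; auto. }
    subst y1; f_equal. apply tp; trivial.
    replace (x2^-1 ** y2) with ((x1 ** x2)^-1 ** (x1 ** y2)) by grp. trivial. }
  exists (map f (list_prod l t)); split.
  - split; [|split; [|split]].
    + intros r hr. apply in_map_iff in hr; destruct hr as ([x y] & <- & hr).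
      apply in_prod_iff in hr. apply subM; trivial; [apply lK | apply hUK, tK]; tauto.
    + apply NoDup_map_NoDup_ForallPairs; [|now apply NoDup_list_prod].
      intros x y hx hy e. apply hinj; trivial. rewrite e.
      apply coset_refl; now apply inter_subgroup.
    + intros x y hx hy h. apply in_map_iff in hx; destruct hx as (x' & <- & hx).
      apply in_map_iff in hy; destruct hy as (y' & <- & hy). f_equal; auto.
    + intros g hg. destruct (lc g hg) as (r & hr & hrg).
      destruct (tc _ hrg) as (s & hs & hsg). exists (f (r, s)); split.
      * apply in_map, in_prod; trivial.
      * unfold f; simpl. split.
        -- replace ((r ** s)^-1 ** g) with (s^-1 ** (r^-1 ** g)) by grp.
           apply subM; trivial. apply subV; auto.
        -- now replace ((r ** s)^-1 ** g) with (s^-1 ** (r^-1 ** g)) by grp.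
  - now rewrite length_map, length_prod.
Qed.

Lemma index_interC K U V n :
  index_eq G K (inter U V) n -> index_eq G K (inter V U) n.
Proof. unfold inter; intros (l & h1 & h2 & h3 & h4); exists l; firstorder. Qed.

Lemma index_unique K U n m : is_subgroup G U ->
  index_eq G K U n -> index_eq G K U m -> n = m.
Proof.
  intros hU hn hm; apply PeanoNat.Nat.le_antisymm;
    eapply index_mono; eauto; intros g hg; trivial.
Qed.

Lemma whole_subgroup : is_subgroup G (whole G).
Proof. repeat split. Qed.

(** Both products equal [G : U ∩ V], computed through [U] and through [V]. *)
Lemma index_exchange U V n m p q : is_subgroup G U -> is_subgroup G V ->
  index_eq G (whole G) U n -> index_eq G (whole G) V m ->
  index_eq G U V p -> index_eq G V U q -> (n * p = m * q)%nat.
Proof.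
  intros hU hV hn hm hp hq.
  apply (index_unique (whole G) (inter U V)); [now apply inter_subgroup| |].
  - apply index_tower; trivial; [apply whole_subgroup | easy].
  - apply index_interC. apply index_tower; trivial; [apply whole_subgroup | easy].
Qed.

Lemma finite_index_inter U V : is_subgroup G U -> is_subgroup G V ->
  finite_index G U -> finite_index G V -> finite_index G (inter U V).
Proof.
  intros hU hV [n hn] [m hm].
  destruct (index_subset_l U (whole G) V m) as (p & hp & _); trivial; [easy|].
  exists (n * p)%nat. apply index_tower; trivial; [apply whole_subgroup | easy].
Qed.

(** * Schreier generators *)

(** The representative [r0] of the trivial coset lies in [T], so right multiplication by [r0^-1]
    changes no coset and turns [r0] into 1. *)
Lemma transversal_one S T n : is_subgroup G S -> is_subgroup G T ->
  index_eq G S T n -> exists l, transversal S T l /\ length l = n /\ In 1 l.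
Proof.
  intros hS hT hi. apply index_eq_transversal in hi; trivial.
  destruct hi as (l & (lS & ln & lp & lc) & <-).
  destruct (lc 1) as (r0 & hr0 & h0); [now apply sub1|].
  rewrite gmul_1r in h0.
  assert (hshift : forall x y, T ((x ** r0^-1)^-1 ** y) -> T (x^-1 ** y)).
  { intros x y h. replace (x^-1 ** y) with (r0^-1 ** ((x ** r0^-1)^-1 ** y)) by grp.
    now apply subM. }
  exists (map (fun x => x ** r0^-1) l); split; [split; [|split; [|split]] | split].
  - intros r hr; apply in_map_iff in hr; destruct hr as (x & <- & hx).
    apply subM; trivial; [|apply subV]; auto.
  - apply NoDup_map_NoDup_ForallPairs; trivial. intros x y hx hy e.
    replace x with (x ** r0^-1 ** r0) by grp. rewrite e. grp.
  - intros x y hx hy h; apply in_map_iff in hx; destruct hx as (x' & <- & hx).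
    apply in_map_iff in hy; destruct hy as (y' & <- & hy). f_equal.
    apply lp; trivial. apply hshift in h.
    replace (x'^-1 ** y') with (x'^-1 ** (y' ** r0^-1) ** r0^-1^-1) by grp.
    apply subM; trivial. now apply subV.
  - intros g hg. destruct (lc g hg) as (r & hr & h). exists (r ** r0^-1); split.
    + apply in_map_iff; now exists r.
    + replace ((r ** r0^-1)^-1 ** g) with (r0^-1^-1 ** (r^-1 ** g)) by grp.
      apply subM; trivial. now apply subV.
  - apply length_map.
  - apply in_map_iff; exists r0; split; trivial; grp.
Qed.

(** The generators are [(rep (s ** r))^-1 ** (s ** r)] for [s] in [l] and [r] in [R]. They generate
    because [S] maps [R] into [R M] under left multiplication. *)
Lemma schreier l S T n : generates G l S -> is_subgroup G T ->
  index_eq G S T n ->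
  exists t, length t = (length l * n)%nat /\ generates G t (inter S T).
Proof.
  intros hl hT hi. assert (hS := generates_subgroup l S hl).
  destruct (transversal_one S T n hS hT hi) as (R & (RS & _ & Rp & Rc) & <- & R1).
  pose (rep := fun x => epsilon (inhabits 1) (fun r => In r R /\ T (r^-1 ** x))).
  assert (hrep : forall x, S x -> In (rep x) R /\ T ((rep x)^-1 ** x)).
  { intros x hx. apply (epsilon_spec (inhabits 1)
      (fun r => In r R /\ T (r^-1 ** x))). auto. }
  pose (f := fun p : G * G => (rep (fst p ** snd p))^-1 ** (fst p ** snd p)).
  set (t := map f (list_prod l R)). set (M := gen G (fun x => In x t)).
  assert (hM : is_subgroup G M) by apply gen_subgroup.
  assert (htST : subset G (fun x => In x t) (inter S T)).
  { intros x hx. apply in_map_iff in hx; destruct hx as ([s r] & <- & hx).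
    apply in_prod_iff in hx; destruct hx as [hs hr]. unfold f; simpl.
    assert (hsr : S (s ** r)).
    { apply subM; trivial; [eapply generates_in; eauto | auto]. }
    split; [|now apply hrep].
    apply subM; trivial. apply subV; trivial. now apply RS, hrep. }
  assert (hMST : subset G M (inter S T)).
  { apply gen_least; trivial; now apply inter_subgroup. }
  (* [P g] says g R ⊆ R M. It is proved together with [P g^-1] so that the property cuts out a
     subgroup. *)
  pose (P := fun g => forall r, In r R -> exists r', In r' R /\ M (r'^-1 ** (g ** r))).
  assert (hP : subset G S (fun g => P g /\ P g^-1)).
  { intros g hg. apply hl in hg. revert g hg. apply gen_least.
    - split; [|split].
      + rewrite ginv_one; split; intros r hr; exists r; split; trivial;
          rewrite gmul_1l; now apply coset_refl.
      + assert (hPM : forall x y, P x -> P y -> P (x ** y)).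
        { intros x y hx hy r hr. destruct (hy r hr) as (r' & hr' & h').
          destruct (hx r' hr') as (r2 & hr2 & h2). exists r2; split; trivial.
          replace (r2^-1 ** (x ** y ** r)) with
            (r2^-1 ** (x ** r') ** (r'^-1 ** (y ** r))) by grp.
          now apply subM. }
        intros x y [hx hx'] [hy hy']; rewrite ginv_mul; split; auto.
      + intros x [hx hx']; rewrite ginv_inv; now split.
    - intros s hs. assert (hsS : S s) by (eapply generates_in; eauto).
      assert (hgen : forall r, In r R -> M ((rep (s ** r))^-1 ** (s ** r))).
      { intros r hr. apply gen_sub, in_map_iff. exists (s, r); split; trivial.
        now apply in_prod. }
      split; intros r hr.
      + exists (rep (s ** r)); split; auto. apply hrep, subM; auto.
      + destruct (Rc (s^-1 ** r)) as (r' & hr' & h').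
        { apply subM; trivial; [apply subV|]; auto. }
        exists r'; split; trivial.
        assert (hsr : S (s ** r')) by (apply subM; auto).
        (* For [s^-1] the required element of [M] is thus the inverse of the Schreier generator
           attached to [s] and [r']. *)
        assert (e : rep (s ** r') = r).
        { destruct (hrep _ hsr) as [hin hT'].
          apply Rp; trivial. apply coset_trans with (s ** r'); trivial.
          replace ((s ** r')^-1 ** r) with (r'^-1 ** (s^-1 ** r)) by grp. trivial. }
        replace (r'^-1 ** (s^-1 ** r)) with ((r^-1 ** (s ** r'))^-1) by grp.
        apply subV; trivial. specialize (hgen r' hr'). now rewrite e in hgen. }
  exists t; split.
  - unfold t; now rewrite length_map, length_prod.
  - intro g; split; [|apply hMST]. intros [hgS hgT].
    (* Applied to 1 in [R], this writes [g] as [r] times an element of [M]; as [g] and [M] lie in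
       [T], so does [r], which forces [r = 1]. *)
    destruct (proj1 (hP g hgS) 1 R1) as (r & hr & h). rewrite gmul_1r in h.
    assert (e : r = 1).
    { apply Rp; trivial. rewrite gmul_1r. apply hMST in h. destruct h as [_ h].
      replace (r^-1) with (r^-1 ** g ** g^-1) by grp.
      apply subM; trivial. now apply subV. }
    subst r. now rewrite ginv_one, gmul_1l in h.
Qed.

(** * Rank gradient and separability *)

Lemma is_rank_exists l S : generates G l S ->
  exists d, is_rank G S d /\ (d <= length l)%nat.
Proof.
  remember (length l) as n eqn:e. revert l e.
  induction n as [n IH] using (well_founded_induction Wf_nat.lt_wf).
  intros l -> hl.
  destruct (classic (exists l', generates G l' S /\ (length l' < length l)%nat))
    as [(l' & hl' & lt) | hno].
  - destruct (IH _ lt l' eq_refl hl') as (d & hd & le). exists d; split; trivial; lia.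
  - exists (length l); split; [split|]; trivial.
    + now exists l.
    + intros l' hl'. apply PeanoNat.Nat.nlt_ge. intro lt; apply hno; now exists l'.
Qed.

(** A finite index m of [W] would satisfy m >= n and eps m <= d(W) - 1 < [length l] < eps n. *)
Lemma infinite_index_of_few_generators eps U n l W : 0 < eps ->
  (forall v, rank_gradient_values G v -> eps <= v) ->
  is_subgroup G U -> index_eq G (whole G) U n ->
  generates G l W -> subset G W U -> INR (length l) < eps * INR n ->
  infinite_index G W.
Proof.
  intros heps hgrad hU hn hl hWU hlt [m hm].
  assert (hW := generates_subgroup l W hl).
  destruct (is_rank_exists l W hl) as (d & hd & hdl).
  assert (hv : eps <= (INR d - 1) / INR m).
  { apply hgrad. now exists W, d, m. }
  assert (hnm := index_mono (whole G) W U m n hU hm hn hWU).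
  apply (index_pos (whole G) W m I), lt_INR in hm. simpl in hm.
  apply le_INR in hnm, hdl.
  apply (Rmult_le_compat_r (INR m)) in hv; [|lra].
  unfold Rdiv in hv; rewrite Rmult_assoc, Rinv_l in hv; [|lra].
  nra.
Qed.

(** Having infinite index, [S] differs from [U]. Separating some [g] of [U] from [S] by a
    finite-index [V] makes the index of U ∩ V at least twice that of [U]. *)
Lemma LERF_large_index S : LERF G -> is_subgroup G S -> fin_gen G S ->
  infinite_index G S -> forall N, exists U n, is_subgroup G U /\ subset G S U /\
    index_eq G (whole G) U n /\ (N <= n)%nat.
Proof.
  intros hL hS hfg hinf N; induction N as [|N (U & n & hU & hSU & hn & hN)].
  - exists (whole G), 1%nat. split; [apply whole_subgroup|].
    split; [easy|]. split; [|lia]. exists (1 :: nil). split; [trivial|].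
    split; [easy|]. split; [intros i j; lia|].
    intros g _; exists 1; split; [now left | exact I].
  - assert (hg : exists g, U g /\ ~ S g).
    { apply NNPP; intro hno. apply hinf.
      assert (hUS : subset G U S).
      { intros g hg. apply NNPP; intro h; apply hno; now exists g. }
      destruct (index_le (whole G) S n (whole G) U) as (m & hm & _); trivial.
      - intros g _; exists g; split; [easy | now apply coset_refl].
      - intros x y _ _; apply hUS.
      - now exists m. }
    destruct hg as (g & hgU & hgS).
    assert (hV : exists V, is_subgroup G V /\ finite_index G V /\
                   subset G S V /\ ~ V g).
    { apply NNPP; intro hno. apply hgS, (hL S hS hfg). intros V hV hf hs.
      apply NNPP; intro h; apply hno; now exists V. }
    destruct hV as (V & hV & [m hm] & hSV & hgV).
    destruct (index_subset_l U (whole G) V m) as (p & hp & _); trivial; [easy|].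
    (* 1 and [g] lie in distinct cosets of [V]. *)
    assert (h2 : (2 <= p)%nat).
    { destruct hp as (l & <- & _ & _ & hc).
      destruct (hc 1 (sub1 U hU)) as (r & hr & h1).
      destruct (hc g hgU) as (s & hs & hsg).
      destruct l as [|x [|y l]]; simpl in hr, hs; [easy| |simpl; lia].
      exfalso; apply hgV. destruct hr as [<- | []], hs as [<- | []].
      rewrite gmul_1r in h1.
      apply subMr with x; trivial. rewrite <- (ginv_inv x); now apply subV. }
    assert (hn0 := index_pos (whole G) U n I hn).
    exists (inter U V), (n * p)%nat. split; [now apply inter_subgroup|].
    split; [intros x hx; split; auto|]. split; [|nia].
    apply index_tower; trivial; [apply whole_subgroup | easy].
Qed.

Lemma LERF_index_gt S eps c : 0 < eps -> LERF G -> is_subgroup G S ->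
  fin_gen G S -> infinite_index G S -> exists U n, is_subgroup G U /\
    subset G S U /\ index_eq G (whole G) U n /\ c < eps * INR n.
Proof.
  intros heps hL hS hf hi.
  destruct (INR_unbounded (c / eps)) as [N hN].
  destruct (LERF_large_index S hL hS hf hi N) as (U & n & hU & hSU & hn & hNn).
  exists U, n. repeat split; trivial; try apply hU.
  apply le_INR in hNn.
  replace c with (eps * (c / eps)) by (field; lra).
  apply Rmult_lt_compat_l; lra.
Qed.

(** The trace of [g] is the set of [r] in [l] with [P g r]. A finite list has finitely many subsets,
    and [t] contains an element of [K] for each trace that occurs. *)
Lemma finitely_many_traces (P : G -> G -> Prop) (l : list G) :
  forall K : G -> Prop, exists t, forall g, K g ->
    exists c, In c t /\ K c /\ forall r, In r l -> (P g r <-> P c r).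
Proof.
  induction l as [|a l IH]; intro K.
  - destruct (classic (exists g, K g)) as [(c & hc) | hno].
    + exists (c :: nil); intros g _; exists c; simpl; tauto.
    + exists nil; intros g hg; exfalso; apply hno; now exists g.
  - destruct (IH (fun g => K g /\ P g a)) as (t1 & h1).
    destruct (IH (fun g => K g /\ ~ P g a)) as (t2 & h2).
    exists (t1 ++ t2). intros g hg. destruct (classic (P g a)) as [ha | ha].
    + destruct (h1 g (conj hg ha)) as (c & hc & [hK hca] & h). exists c.
      split; [apply in_or_app; now left|]. split; [trivial|].
      intros r [<- | hr]; [tauto | auto].
    + destruct (h2 g (conj hg ha)) as (c & hc & [hK hca] & h). exists c.
      split; [apply in_or_app; now right|]. split; [trivial|].
      intros r [<- | hr]; [tauto | auto].
Qed.

(* [U] is the stabilizer of the set [A V]. *)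
Lemma finite_index_within_product A V : is_subgroup G A -> is_subgroup G V ->
  finite_index G V -> exists U, is_subgroup G U /\ finite_index G U /\
    subset G A U /\ forall u, U u -> exists a, A a /\ V (a^-1 ** u).
Proof.
  intros hA hV [n hn].
  pose (Q := fun g => exists a, A a /\ V (a^-1 ** g)).
  assert (hQ : forall x y, V (x^-1 ** y) -> Q x -> Q y).
  { intros x y h (a & ha & hax). exists a; split; trivial.
    now apply coset_trans with x. }
  assert (hQA : forall a g, A a -> Q g -> Q (a ** g)).
  { intros a g ha (b & hb & h). exists (a ** b); split; [now apply subM|].
    now replace ((a ** b)^-1 ** (a ** g)) with (b^-1 ** g) by grp. }
  set (U := fun u => forall g, Q g <-> Q (u ** g)).
  assert (hU : is_subgroup G U).
  { split; [|split].
    - intro g; now rewrite gmul_1l.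
    - intros x y hx hy g. rewrite gmul_assoc_r, <- (hx (y ** g)). apply hy.
    - intros x hx g. rewrite (hx (x^-1 ** g)). now rewrite gmul_Vr_cancel. }
  exists U; split; [trivial|]. split; [|split].
  - destruct (index_cover _ _ _ hn) as (l & _ & hc).
    (* [Q] is A V, a union of left cosets of [V], so the translate g Q is determined by which
       representatives [r] it contains. If [g] and [c] have the same trace, then g Q = c Q and
       [c^-1 ** g] stabilizes [Q]. *)
    destruct (finitely_many_traces (fun g r => Q (g^-1 ** r)) l (whole G))
      as (t & ht).
    destruct (index_of_cover (whole G) U t hU) as (m & hm & _); [|now exists m].
    intros g hg. destruct (ht g hg) as (c & hct & _ & hcg).
    exists c; split; trivial. intro x.
    destruct (hc (g ** x) I) as (r & hr & hrx).
    assert (hr' : forall z, Q (z^-1 ** r) <-> Q (z^-1 ** (g ** x))).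
    { intro z; split; apply hQ.
      - now replace ((z^-1 ** r)^-1 ** (z^-1 ** (g ** x)))
          with (r^-1 ** (g ** x)) by grp.
      - replace ((z^-1 ** (g ** x))^-1 ** (z^-1 ** r))
          with ((g ** x)^-1 ** r) by grp.
        now apply coset_sym. }
    rewrite gmul_assoc_r, <- hr', <- (hcg r hr), hr'.
    now rewrite gmul_Vl_cancel.
  - intros a ha g; split; [now apply hQA|]. intro h.
    rewrite <- (gmul_Vl_cancel a g). apply hQA; trivial. now apply subV.
  - intros u hu. change (Q u). rewrite <- (gmul_1r G u). apply (hu 1).
    exists 1; split; [now apply sub1 | now apply coset_refl].
Qed.

Lemma inter_sub_r U V : subset G (inter U V) V.
Proof. now intros g []. Qed.

Lemma infinite_index_inter_join eps A B : 0 < eps ->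
  (forall v, rank_gradient_values G v -> eps <= v) -> LERF G ->
  is_subgroup G A -> fin_gen G A -> infinite_index G A ->
  is_subgroup G B -> fin_gen G B -> infinite_index G B ->
  exists U V, is_subgroup G U /\ is_subgroup G V /\
    finite_index G U /\ finite_index G V /\
    fin_gen G (gen G (fun x => inter A V x \/ inter B U x)) /\
    infinite_index G (gen G (fun x => inter A V x \/ inter B U x)).
Proof.
  intros heps hgrad hL hA [la hla] iA hB [lb hlb] iB.
  (* The factor 2, here and for [B], reserves half of the allowed number of generators for each of
     the two subgroups. *)
  destruct (LERF_index_gt A eps (2 * INR (length la)) heps hL hA
    (ex_intro _ la hla) iA) as (U & n & hU & hAU & hn & hna).
  destruct (LERF_index_gt B eps (2 * INR (length lb)) heps hL hB
    (ex_intro _ lb hlb) iB) as (V & m & hV & hBV & hm & hmb).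
  destruct (index_subset_l U (whole G) V m) as (p & hp & _); trivial; [easy|].
  destruct (index_subset_l V (whole G) U n) as (q & hq & _); trivial; [easy|].
  assert (hex := index_exchange U V n m p q hU hV hn hm hp hq).
  destruct (index_subset_l A U V p) as (p' & hp' & lep); trivial.
  destruct (index_subset_l B V U q) as (q' & hq' & leq); trivial.
  destruct (schreier la A V p' hla hV hp') as (ta & eta & hta).
  destruct (schreier lb B U q' hlb hU hq') as (tb & etb & htb).
  assert (hgen := generates_union ta tb _ _ hta htb).
  exists U, V. split; [trivial|]. split; [trivial|].
  split; [now exists n|]. split; [now exists m|].
  split; [now exists (ta ++ tb)|].
  apply (infinite_index_of_few_generators eps (inter U V) (n * p) (ta ++ tb)); trivial.
  - now apply inter_subgroup.
  - apply index_tower; trivial; [apply whole_subgroup | easy].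
  - apply gen_least; [now apply inter_subgroup|].
    intros g [[h1 h2] | [h1 h2]]; split; auto.
  (* Multiplying the two index bounds by [p] and [q] and adding gives 2 (|la| p + |lb| q) < eps (n p
     + m q) = 2 eps n p. *)
  - assert (0 < p)%nat by (apply (index_pos U V); trivial; now apply sub1).
    assert (0 < q)%nat by (apply (index_pos V U); trivial; now apply sub1).
    rewrite length_app, eta, etb, plus_INR, !mult_INR.
    assert (hex' : INR n * INR p = INR m * INR q) by (rewrite <- !mult_INR; now f_equal).
    apply le_INR in lep, leq. apply (lt_INR 0) in H, H0. simpl in H, H0.
    assert (ha := pos_INR (length la)). assert (hb := pos_INR (length lb)).
    assert (INR (length la) * INR p' <= INR (length la) * INR p)
      by now apply Rmult_le_compat_l.
    assert (INR (length lb) * INR q' <= INR (length lb) * INR q)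
      by now apply Rmult_le_compat_l.
    apply (Rmult_lt_compat_r (INR p)) in hna; trivial.
    apply (Rmult_lt_compat_r (INR q)) in hmb; trivial.
    nra.
Qed.

End Subgroups.

(** * Second use of separability and the choice of [H] *)

Theorem theorem1p1 (G : Group) :
  fin_gen G (whole G) -> LERF G -> rank_gradient_pos G ->
  forall A B : G -> Prop,
    is_subgroup G A -> fin_gen G A -> infinite_index G A ->
    is_subgroup G B -> fin_gen G B -> infinite_index G B ->
    exists H : G -> Prop,
      is_subgroup G H /\ subset G H B /\ finite_index_in G B H /\
      infinite_index G (gen G (fun x => A x \/ H x)).
Proof.
  intros _ hL [eps [heps hgrad]] A B hA fA iA hB fB iB.
  destruct (infinite_index_inter_join G eps A B heps hgrad hL hA fA iA hB fB iB)
    as (U & V & hU & hV & [n hn] & [m hm] & fK & iK).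
  set (K := gen G _) in fK, iK.
  destruct fA as [la hla], fB as [lb hlb].
  destruct (index_subset_l G A (whole G) V m) as (k & hk & _); trivial; [easy|].
  destruct (index_subset_l G B (whole G) U n) as (q0 & hq0 & _); trivial; [easy|].
  destruct (schreier G lb B U q0 hlb hU hq0) as (lb0 & _ & hlb0).
  (* [length lb0] counts generators of B ∩ U, and [k] will bound [U2 : U2 ∩ V2]; the factor 2 again
     leaves half of the generators for [A]. *)
  destruct (LERF_index_gt G K eps (2 * (INR (length lb0) * INR k)) heps hL
    (gen_subgroup G _) fK iK) as (V2 & m2 & hV2 & hKV2 & hm2 & hm2b).
  destruct (finite_index_within_product G A V2 hA hV2 (ex_intro _ m2 hm2))
    as (U1 & hU1 & fU1 & hAU1 & hU1V2).
  destruct (LERF_index_gt G A eps (2 * INR (length la)) heps hL hA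
    (ex_intro _ la hla) iA) as (U3 & n3 & hU3 & hAU3 & hn3 & hn3a).
  set (U2 := inter G U1 U3).
  assert (hU2 : is_subgroup G U2) by now apply inter_subgroup.
  destruct (finite_index_inter G U1 U3 hU1 hU3 fU1 (ex_intro _ n3 hn3)) as [n2 hn2].
  fold U2 in hn2.
  assert (hn32 := index_mono G (whole G) U2 U3 n2 n3 hU3 hn2 hn3
    (inter_sub_r G U1 U3)).
  (* Each coset of [V2] met by [U2] contains an element of [A], since U2 ⊆ A V2. Elements of [A]
     congruent modulo [V] differ by an element of A ∩ V ⊆ K ⊆ V2. *)
  destruct (index_le G U2 V2 k A V) as (p & hp & hpk); trivial.
  { intros g [hg _]. now apply hU1V2. }
  { intros x y hx hy h. apply hKV2, gen_sub. left; split; trivial.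
    apply subM; trivial. now apply subV. }
  destruct (index_subset_l G V2 (whole G) U2 n2) as (q & hq & _); trivial; [easy|].
  assert (hex := index_exchange G U2 V2 n2 m2 p q hU2 hV2 hn2 hm2 hp hq).
  (* B ∩ U ⊆ K ⊆ V2 gives q' <= q. *)
  destruct (index_subset_l G (inter G B U) V2 U2 q) as (q' & hq' & hqq); trivial.
  { intros g hg. apply hKV2, gen_sub. now right. }
  destruct (schreier G lb0 (inter G B U) U2 q' hlb0 hU2 hq') as (t & et & ht).
  exists (inter G (inter G B U) U2).
  split; [repeat apply inter_subgroup; trivial|].
  split; [now intros g [[hg _] _]|].
  split.
  - destruct (finite_index_inter G U U2 hU hU2 (ex_intro _ n hn)
      (ex_intro _ n2 hn2)) as [j hj].
    destruct (index_subset_l G B (whole G) (inter G U U2) j) as (i & hi & _);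
      trivial; [now apply inter_subgroup | easy |].
    (* On [B], congruence modulo B ∩ U ∩ U2 is the same as congruence modulo U ∩ U2. *)
    destruct (index_le G B (inter G (inter G B U) U2) i B (inter G U U2))
      as (i' & hi' & _); trivial.
    + repeat apply inter_subgroup; trivial.
    + intros g hg; exists g; split; trivial. apply coset_refl.
      repeat apply inter_subgroup; trivial.
    + intros x y hx hy [h1 h2]. split; [split|]; trivial.
      apply subM; trivial. now apply subV.
    + now exists i'.
  - apply (infinite_index_of_few_generators G eps U2 n2 (la ++ t)); trivial.
    + now apply generates_union.
    + apply gen_least; trivial.
      intros g [h | [_ h]]; [split; auto | trivial].
    + assert (hm0 := index_pos G _ _ _ I hm2). assert (hn0 := index_pos G _ _ _ I hn2).
      rewrite length_app, et, plus_INR, mult_INR.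
      assert (hex' : INR n2 * INR p = INR m2 * INR q)
        by (rewrite <- !mult_INR; now f_equal).
      apply le_INR in hn32, hpk, hqq. apply (lt_INR 0) in hm0, hn0.
      simpl in hm0, hn0.
      set (b := INR (length lb0)) in *.
      assert (hb : 0 <= b) by apply pos_INR.
      assert (h1 : 2 * INR (length la) < eps * INR n2) by nra.
      assert (h2 : b * INR q' <= b * INR q) by now apply Rmult_le_compat_l.
      (* After multiplication by [m2], the exchange identity n2 p = m2 q gives 2 b q m2 = 2 b p n2
         <= 2 b k n2 < eps m2 n2. *)
      assert (h3 : 2 * (b * INR q) < eps * INR n2); [|lra].
      apply (Rmult_lt_reg_r (INR m2)); trivial.
      replace (2 * (b * INR q) * INR m2) with (2 * (b * INR p) * INR n2)
        by (transitivity (2 * b * (INR n2 * INR p)); [ring | rewrite hex'; ring]).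
      assert (h4 : b * INR p <= b * INR k) by now apply Rmult_le_compat_l.
      apply (Rmult_lt_compat_r (INR n2)) in hm2b; trivial.
      nra.
Qed.
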